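(* Let $a_1,a_2,a_3,b_1,b_2\in\mathbb{C}$. If $b_1b_2\neq 0$, then $\chi_3(\lambda,w)$ is reducible in $\mathbb{C}[\lambda,w]$ if and only if it has a constant branch, i.e. a factor $\lambda+a$ with $a\in\mathbb{C}$. More explicitly, this happens if and only if \[ a_1=a_3\qquad\text{or}\qquad (a_3-a_2)b_1^2+(a_1-a_2)b_2^2=0. \] If $b_1=0$ or $b_2=0$, then the chain is disconnected and $\chi_3$ is reducible.
   Context: $\chi_3(\lambda,w)=\det(\lambda I+A+wB)$, where $A=\operatorname{diag}(a_1,a_2,a_3)$ and $B$ is the $3\times3$ symmetric tridiagonal matrix with zero diagonal and $B_{i,i+1}=B_{i+1,i}=b_i$, $i=1,2$. *)

(* Defs.v *)
From mathcomp Require Import all_boot all_order all_algebra.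
From mathcomp Require Import reals.
From mathcomp Require Import complex.

Set Implicit Arguments.
Unset Strict Implicit.
Unset Printing Implicit Defensive.
Import GRing.Theory.
Local Open Scope ring_scope.

(* Zero counts as neither reducible nor irreducible. *)
Definition reducible (D : idomainType) (p : D) : Prop :=
  p != 0 /\
  exists q r : D,
    [/\ q \isn't a GRing.unit, r \isn't a GRing.unit & p = q * r].

Section Chain.
Variables (K : fieldType) (n : nat).

Definition diagA (a : seq K) : 'M[K]_n :=
  diag_mx (\row_(j < n) a`_j).

(* The sequence b is 0-based: b`_i couples the sites i and i.+1. *)
Definition tridiagB (b : seq K) : 'M[K]_n :=
  \matrix_(i < n, j < n)
    if j == i.+1 :> nat then b`_i
    else if i == j.+1 :> nat then b`_j
    else 0.

(* K[lambda, w] is represented as K[w][lambda]. *)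
Definition lambda : {poly {poly K}} := 'X.
Definition w : {poly {poly K}} := 'X%:P.
Definition cst (c : K) : {poly {poly K}} := c%:P%:P.

Definition chi (a b : seq K) : {poly {poly K}} :=
  \det (lambda%:M + map_mx cst (diagA a) + w *: map_mx cst (tridiagB b)).

Definition has_constant_branch (p : {poly {poly K}}) : Prop :=
  exists (a : K) (q : {poly {poly K}}), p = (lambda + cst a) * q.

(* The chain is the graph on the n sites whose edges are the nonzero
   couplings, i.e. the nonzero entries of B. *)
Definition chain_connected (b : seq K) : Prop :=
  forall i j : 'I_n, connect [rel k l | tridiagB b k l != 0] i j.

End Chain.

(* Main.v *)
Require Import Defs.
From mathcomp Require Import all_boot all_order all_algebra.
From mathcomp Require Import reals.
From mathcomp Require Import complex.
From mathcomp Require Import zify ring.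

Set Implicit Arguments.
Unset Strict Implicit.
Unset Printing Implicit Defensive.
Import GRing.Theory.
Local Open Scope ring_scope.

(** The determinant is the monic cubic in lambda
      (lambda + a1)(lambda + a2)(lambda + a3)
        - w^2 (b2^2 (lambda + a1) + b1^2 (lambda + a3)).
    Being monic of degree 3 over the domain K[w], it is reducible only if it has
    a root g in K[w] ([reducible_monic_cubic_root]).  Comparing degrees in w, a
    root g is affine, g = alpha w + beta ([cubic_root_size]).  With
    ci = beta + ai, the coefficients of 1, w, w^2 and w^3 then give
      c1 c2 c3 = 0,                 alpha (c1 c2 + c1 c3 + c2 c3) = 0,
      alpha^2 (c1 + c2 + c3) = b2^2 c1 + b1^2 c3,
      alpha^3 = alpha (b1^2 + b2^2).
    If alpha != 0, two of the ci vanish, and the last two equations force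
    c1 = c3, i.e. a1 = a3.  If alpha = 0, then c1 = 0 or c3 = 0 gives
    c1 = c3 = 0, while c2 = 0 gives the second condition.  Conversely, lambda + a1
    divides the cubic when a1 = a3, and lambda + a2 divides it under the second
    condition, so each of the two conditions even produces a constant branch.
    When b1 = 0 or b2 = 0, an end site carries no edge, and lambda + a1, resp.
    lambda + a3, divides the cubic.
    No property of the complex numbers is needed beyond their being a field. *)

(** * Factors of monic polynomials over a domain *)

Section MonicFactors.
Variable D : idomainType.
Implicit Types p q r : {poly D}.

Lemma monic_mul_lead_unit q r : q * r \is monic ->
  lead_coef q \is a GRing.unit.
Proof.
move=> /monicP; rewrite lead_coefM => qr1.
by apply/unitrP; exists (lead_coef r); rewrite qr1 mulrC.
Qed.

Lemma lead_unit_nonunit_size q : lead_coef q \is a GRing.unit ->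
  q \isn't a GRing.unit -> (1 < size q)%N.
Proof.
move=> uq nuq.
have q0 : size q != 0%N.
  by apply: contraTneq uq => /eqP; rewrite size_poly_eq0 => /eqP->;
    rewrite lead_coef0 unitr0.
rewrite ltnNge; apply: contra nuq => sq.
have sq1 : size q = 1 by lia.
by move: uq; rewrite lead_coefE poly_unitE sq1.
Qed.

Lemma size2_lead_unit_root q : size q = 2 -> lead_coef q \is a GRing.unit ->
  exists x, root q x.
Proof.
move=> sq; rewrite lead_coefE sq /= => uq; exists (- (q`_0 / q`_1)).
by rewrite rootE horner_coef sq !big_ord_recr big_ord0 /= add0r expr0 mulr1
  expr1 mulrN mulrC divrK // subrr.
Qed.

Lemma reducible_monic_cubic_root p : p \is monic -> size p = 4 ->
  reducible p -> exists x, root p x.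
Proof.
move=> pmon sp [_ [q [r [nuq nur pE]]]].
have uq : lead_coef q \is a GRing.unit.
  by apply: (@monic_mul_lead_unit q r); rewrite -pE.
have ur : lead_coef r \is a GRing.unit.
  by apply: (@monic_mul_lead_unit r q); rewrite mulrC -pE.
have sq := lead_unit_nonunit_size uq nuq.
have sr := lead_unit_nonunit_size ur nur.
have sqr : (size q + size r = 5)%N.
  by move: sp; rewrite pE size_mul -?size_poly_gt0; lia.
have [sq2 | sr2] : size q = 2 \/ size r = 2 by lia.
  have [x qx] := size2_lead_unit_root sq2 uq.
  by exists x; rewrite pE rootM qx.
have [x rx] := size2_lead_unit_root sr2 ur.
by exists x; rewrite pE rootM rx orbT.
Qed.

End MonicFactors.

(** * The three-site characteristic polynomial *)

Section ThreeSites.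
Variable K : fieldType.
Implicit Types a b c : K.

Lemma chi3E a1 a2 a3 b1 b2 :
  chi 3 [:: a1; a2; a3] [:: b1; b2] =
    (lambda K + cst a1) * (lambda K + cst a2) * (lambda K + cst a3)
    - w K ^+ 2 * (cst b2 ^+ 2 * (lambda K + cst a1)
                  + cst b1 ^+ 2 * (lambda K + cst a3)).
Proof.
have cst0 : cst (0 : K) = 0 by rewrite /cst !polyC0.
rewrite /chi (expand_det_row _ ord0) !big_ord_recl big_ord0 /cofactor.
rewrite !(expand_det_row _ ord0) !big_ord_recl !big_ord0 /cofactor !det_mx11.
rewrite !mxE /= ?cst0 ?mulr0n ?mulr1n ?cst0.
rewrite /bump /= ?cst0.
by ring.
Qed.

Lemma size_chi3_monic a1 a2 a3 b1 b2 :
  size (chi 3 [:: a1; a2; a3] [:: b1; b2]) = 4 /\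
  chi 3 [:: a1; a2; a3] [:: b1; b2] \is monic.
Proof.
set p := chi _ _ _.
(* In powers of lambda, chi = m - (c1 lambda + c0) with m the monic cubic. *)
set c1 := ('X ^+ 2 * (b2%:P ^+ 2 + b1%:P ^+ 2)) : {poly K}.
set c0 := ('X ^+ 2 * (b2%:P ^+ 2 * a1%:P + b1%:P ^+ 2 * a3%:P)) : {poly K}.
set m := (lambda K + cst a1) * (lambda K + cst a2) * (lambda K + cst a3).
have mmon : m \is monic by rewrite !monicMr ?monicXaddC.
have sm : size m = 4.
  by rewrite !size_Mmonic ?monicMr ?monicXaddC ?monic_neq0 ?size_XaddC //
    ?monicXaddC ?monicMr ?monicXaddC.
have sl : (size (- (c1 *: 'X + c0%:P)) < size m)%N.
  rewrite sm size_polyN; apply: leq_ltn_trans (size_polyD _ _) _.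
  rewrite gtn_max (leq_ltn_trans (size_scale_leq _ _)) ?size_polyX //=.
  by rewrite (leq_ltn_trans (size_polyC_leq1 _)).
have -> : p = m - (c1 *: 'X + c0%:P).
  rewrite /p chi3E /m /c1 /c0 -mul_polyC /lambda /w /cst.
  by rewrite !(rmorphM, rmorphD, rmorphXn) /=; ring.
by rewrite size_polyDl // monicE lead_coefDl // -monicE.
Qed.

Lemma size_chi3 a1 a2 a3 b1 b2 :
  size (chi 3 [:: a1; a2; a3] [:: b1; b2]) = 4.
Proof. by case: (size_chi3_monic a1 a2 a3 b1 b2). Qed.

Lemma chi3_monic a1 a2 a3 b1 b2 :
  chi 3 [:: a1; a2; a3] [:: b1; b2] \is monic.
Proof. by case: (size_chi3_monic a1 a2 a3 b1 b2). Qed.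

Lemma horner_chi3 a1 a2 a3 b1 b2 (g : {poly K}) :
  (chi 3 [:: a1; a2; a3] [:: b1; b2]).[g] =
    (g + a1%:P) * (g + a2%:P) * (g + a3%:P)
    - 'X ^+ 2 * (b2%:P ^+ 2 * (g + a1%:P) + b1%:P ^+ 2 * (g + a3%:P)).
Proof. by rewrite chi3E /lambda /w /cst !hornerE. Qed.

(** If g has degree d > 1 in w, the cubic term has degree 3 d, the other one
    degree at most d + 2. *)
Lemma cubic_root_size a1 a2 a3 b1 b2 (g : {poly K}) :
  (g + a1%:P) * (g + a2%:P) * (g + a3%:P) =
    'X ^+ 2 * (b2%:P ^+ 2 * (g + a1%:P) + b1%:P ^+ 2 * (g + a3%:P)) ->
  (size g <= 2)%N.
Proof.
move=> gE; rewrite leqNgt; apply/negP => sg.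
have sgD c : size (g + c%:P) = size g.
  by rewrite size_polyDl // (leq_ltn_trans (size_polyC_leq1 _)) // ltnW.
have gD0 c : g + c%:P != 0 by rewrite -size_poly_gt0 sgD; lia.
have sl : size ((g + a1%:P) * (g + a2%:P) * (g + a3%:P)) = (3 * size g - 2)%N.
  by rewrite !size_mul ?mulf_neq0 // !sgD; lia.
have sZ b c : (size (b%:P ^+ 2 * (g + c%:P))%R <= size g)%N.
  by rewrite -rmorphXn /= mul_polyC -(sgD c) size_scale_leq.
have sr : (size ('X ^+ 2 * (b2%:P ^+ 2 * (g + a1%:P) + b1%:P ^+ 2 * (g + a3%:P)))%R
           <= (size g).+2)%N.
  apply: leq_trans (size_polyMleq _ _) _; rewrite size_polyXn /= !ltnS.
  by apply: leq_trans (size_polyD _ _) _; rewrite geq_max !sZ.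
by move: sr; rewrite -gE sl; lia.
Qed.

(** An affine root g = al w + be, read off coefficient by coefficient in w. *)
Lemma chi3_root_coefs a1 a2 a3 b1 b2 (g : {poly K}) :
  root (chi 3 [:: a1; a2; a3] [:: b1; b2]) g ->
  exists al be : K,
    let c1 := be + a1 in let c2 := be + a2 in let c3 := be + a3 in
    [/\ c1 * c2 * c3 = 0,
        al * (c1 * c2 + c1 * c3 + c2 * c3) = 0,
        al ^+ 2 * (c1 + c2 + c3) = b2 ^+ 2 * c1 + b1 ^+ 2 * c3 &
        al ^+ 3 = al * (b1 ^+ 2 + b2 ^+ 2)].
Proof.
rewrite rootE horner_chi3 => /eqP g0; exists g`_1, g`_0 => c1 c2 c3.
have sg : (size g <= 2)%N by apply: cubic_root_size; exact: subr0_eq g0.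
have gE : g = g`_1 *: 'X + (g`_0)%:P.
  apply/polyP => -[|[|i]]; rewrite !coefE /= ?mulr0 ?mulr1 ?add0r ?addr0 //.
  by rewrite nth_default // (leq_trans sg).
move: (g`_1) (g`_0) gE @c1 @c2 @c3 => al be gE c1 c2 c3.
pose d0 := c1 * c2 * c3.
pose d1 := al * (c1 * c2 + c1 * c3 + c2 * c3).
pose d2 := al ^+ 2 * (c1 + c2 + c3) - (b2 ^+ 2 * c1 + b1 ^+ 2 * c3).
pose d3 := al ^+ 3 - al * (b1 ^+ 2 + b2 ^+ 2).
have dE : Poly [:: d0; d1; d2; d3] = 0.
  rewrite -g0 gE /= !cons_poly_def /d0 /d1 /d2 /d3 /c1 /c2 /c3 -mul_polyC.
  by rewrite !(rmorphM, rmorphD, rmorphN, rmorphXn) /=; ring.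
have d i : [:: d0; d1; d2; d3]`_i = 0 by rewrite -coef_Poly dE coef0.
by split; [exact: (d 0) | exact: (d 1) | | ]; apply/eqP; rewrite -subr_eq0;
  apply/eqP; [exact: (d 2) | exact: (d 3)].
Qed.

Lemma chi3_root_cond a1 a2 a3 b1 b2 (g : {poly K}) : b1 * b2 != 0 ->
  root (chi 3 [:: a1; a2; a3] [:: b1; b2]) g ->
  a1 = a3 \/ (a3 - a2) * b1 ^+ 2 + (a1 - a2) * b2 ^+ 2 = 0.
Proof.
rewrite mulf_eq0 negb_or => /andP[b1n0 b2n0].
have b1sq : b1 ^+ 2 != 0 by rewrite expf_neq0.
have b2sq : b2 ^+ 2 != 0 by rewrite expf_neq0.
move=> /chi3_root_coefs [al [be]] /= [e0 e1 e2 e3].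
have a13 : be + a1 = 0 -> be + a3 = 0 -> a1 = a3.
  by move=> c1 c3; apply: (@addrI _ be); rewrite c1 c3.
have [al0 | aln0] := eqVneq al 0.
  have {}e2 : b2 ^+ 2 * (be + a1) + b1 ^+ 2 * (be + a3) = 0.
    by rewrite -e2 al0 expr0n mul0r.
  move/eqP: e0; rewrite !mulf_eq0 -orbA => /or3P[] /eqP c0.
  - left; apply: a13 => //; apply: (mulfI b1sq).
    by rewrite mulr0 -e2 c0 mulr0 add0r.
  - have beE : be = - a2 by apply/eqP; rewrite -addr_eq0 c0.
    by right; rewrite -e2 beE; ring.
  - left; apply: a13 => //; apply: (mulfI b2sq).
    by rewrite mulr0 -e2 c0 mulr0 addr0.
left.
have {}e1 := mulfI aln0 (etrans e1 (esym (mulr0 al))).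
have {}e3 : al ^+ 2 = b1 ^+ 2 + b2 ^+ 2 by apply: (mulfI aln0); rewrite -e3 exprS.
rewrite e3 in e2.
apply: (@addrI _ be).
move: (be + a1) (be + a2) (be + a3) e0 e1 e2 => c1 c2 c3 e0 e1 e2.
(* Both c1 c2 c3 and c1 c2 + c1 c3 + c2 c3 are zero, so two of the ci vanish. *)
have two c c' c'' : c = 0 -> c * c' + c * c'' + c' * c'' = 0 ->
    c' = 0 \/ c'' = 0.
  move=> ->; rewrite !mul0r !add0r => /eqP.
  by rewrite mulf_eq0 => /orP[] /eqP; [left | right].
have [[z1 z2] | [[z1 z3] | [z2 z3]]] :
    (c1 = 0 /\ c2 = 0) \/ (c1 = 0 /\ c3 = 0) \/ (c2 = 0 /\ c3 = 0).
  move/eqP: e0; rewrite !mulf_eq0 -orbA => /or3P[] /eqP z.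
  - by case: (two c1 c2 c3 z e1); tauto.
  - have e1' : c2 * c1 + c2 * c3 + c1 * c3 = 0 by rewrite -e1; ring.
    by case: (two c2 c1 c3 z e1'); tauto.
  - have e1' : c3 * c1 + c3 * c2 + c1 * c2 = 0 by rewrite -e1; ring.
    by case: (two c3 c1 c2 z e1'); tauto.
- have : b2 ^+ 2 * c3 = 0.
    by move/eqP: e2; rewrite -subr_eq0 z1 z2 => /eqP <-; ring.
  by move/eqP; rewrite mulf_eq0 (negPf b2sq) z1 => /eqP ->.
- by rewrite z1 z3.
- have : b1 ^+ 2 * c1 = 0.
    by move/eqP: e2; rewrite -subr_eq0 z2 z3 => /eqP <-; ring.
  by move/eqP; rewrite mulf_eq0 (negPf b1sq) z3 => /eqP ->.
Qed.

Lemma chi3_branch_outer a1 a2 b1 b2 :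
  has_constant_branch (chi 3 [:: a1; a2; a1] [:: b1; b2]).
Proof.
exists a1, ((lambda K + cst a2) * (lambda K + cst a1)
            - w K ^+ 2 * (cst b1 ^+ 2 + cst b2 ^+ 2)).
by rewrite chi3E; ring.
Qed.

Lemma chi3_branch_middle a1 a2 a3 b1 b2 :
  (a3 - a2) * b1 ^+ 2 + (a1 - a2) * b2 ^+ 2 = 0 ->
  has_constant_branch (chi 3 [:: a1; a2; a3] [:: b1; b2]).
Proof.
move=> h; exists a2, ((lambda K + cst a1) * (lambda K + cst a3)
                      - w K ^+ 2 * (cst b1 ^+ 2 + cst b2 ^+ 2)).
have : cst ((a3 - a2) * b1 ^+ 2 + (a1 - a2) * b2 ^+ 2) = 0.
  by rewrite h /cst !polyC0.
rewrite /cst !(rmorphM, rmorphD, rmorphN, rmorphXn) /= -!/(cst _) => hc.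
rewrite chi3E; apply/eqP; rewrite -subr_eq0 -oppr_eq0; apply/eqP.
rewrite -[RHS](mulr0 (w K ^+ 2)) -hc.
by ring.
Qed.

Lemma chi3_branch_b1_eq0 a1 a2 a3 b2 :
  has_constant_branch (chi 3 [:: a1; a2; a3] [:: 0; b2]).
Proof.
exists a1, ((lambda K + cst a2) * (lambda K + cst a3) - w K ^+ 2 * cst b2 ^+ 2).
by rewrite chi3E (_ : cst 0 = 0) ?/cst ?polyC0 //; ring.
Qed.

Lemma chi3_branch_b2_eq0 a1 a2 a3 b1 :
  has_constant_branch (chi 3 [:: a1; a2; a3] [:: b1; 0]).
Proof.
exists a3, ((lambda K + cst a1) * (lambda K + cst a2) - w K ^+ 2 * cst b1 ^+ 2).
by rewrite chi3E (_ : cst 0 = 0) ?/cst ?polyC0 //; ring.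
Qed.

Lemma constant_branch_reducible a1 a2 a3 b1 b2 :
  has_constant_branch (chi 3 [:: a1; a2; a3] [:: b1; b2]) ->
  reducible (chi 3 [:: a1; a2; a3] [:: b1; b2]).
Proof.
have := size_chi3 a1 a2 a3 b1 b2; set p := chi _ _ _ => sp [a [q pE]].
have p0 : p != 0 by rewrite -size_poly_gt0 sp.
split=> //; exists (lambda K + cst a), q; split=> //.
  by rewrite poly_unitE size_XaddC.
have q0 : q != 0 by apply: contraNneq p0 => q0; rewrite pE q0 mulr0.
move: sp; rewrite pE size_monicM ?monicXaddC // size_XaddC poly_unitE.
by case: eqP => // ->.
Qed.

(** * Disconnected chains *)

Lemma tridiagB_edgeless_site n (b : seq K) (i j : 'I_n) : i != j ->
  (forall k, tridiagB n b i k = 0) -> ~ chain_connected n b.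
Proof.
move=> neq_ij iso /(_ i j) /connectP[[|k s] /=].
  by move=> _ /eqP; rewrite eq_sym (negPf neq_ij).
by rewrite iso eqxx.
Qed.

Lemma chain3_disconnected b1 b2 : b1 = 0 \/ b2 = 0 ->
  ~ chain_connected 3 [:: b1; b2].
Proof.
case=> ->.
- apply: (@tridiagB_edgeless_site _ _ ord0 ord_max) => // -[[|[|[|k]]] hk] //;
  by rewrite mxE.
- apply: (@tridiagB_edgeless_site _ _ ord_max ord0) => // -[[|[|[|k]]] hk] //;
  by rewrite mxE.
Qed.

End ThreeSites.

Theorem proposition4p2 (R : realType) (a1 a2 a3 b1 b2 : R[i]) :
  let chi3 := chi 3 [:: a1; a2; a3] [:: b1; b2] in
  (b1 * b2 != 0 ->
     (reducible chi3 <-> has_constant_branch chi3) /\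
     (reducible chi3 <->
        a1 = a3 \/ (a3 - a2) * b1 ^+ 2 + (a1 - a2) * b2 ^+ 2 = 0)) /\
  (b1 = 0 \/ b2 = 0 ->
     ~ chain_connected 3 [:: b1; b2] /\ reducible chi3).
Proof.
move=> chi3; split=> [bn0 | b0].
  have red_cond : reducible chi3 ->
      a1 = a3 \/ (a3 - a2) * b1 ^+ 2 + (a1 - a2) * b2 ^+ 2 = 0.
    case/(reducible_monic_cubic_root (chi3_monic _ _ _ _ _)
           (size_chi3 _ _ _ _ _)) => g.
    exact: chi3_root_cond.
  have cond_branch : a1 = a3 \/
      (a3 - a2) * b1 ^+ 2 + (a1 - a2) * b2 ^+ 2 = 0 ->
      has_constant_branch chi3.
    case=> [a13 | ]; last exact: chi3_branch_middle.
    by rewrite /chi3 -a13; apply: chi3_branch_outer.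
  have branch_red : has_constant_branch chi3 -> reducible chi3.
    exact: constant_branch_reducible.
  by split; split; auto.
split; first exact: chain3_disconnected.
apply: constant_branch_reducible.
by case: b0 => ->; [apply: chi3_branch_b1_eq0 | apply: chi3_branch_b2_eq0].
Qed.
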